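(* Consider the equilibrium of the $n$-firm economy as a function of the climate belief $\alpha_j^2$ of a single firm $j$, all other parameters being fixed, for $\alpha_j^2$ ranging over an interval $J\subseteq(0,\infty)$ of regime-preserving perturbations (see context). Let $r_i$ be the equilibrium technology choice of any firm $i$, seen as a function of $\alpha_j^2\in J$. (i) If $j=i$, then $r_i$ is weakly decreasing on $J$ (in $i$'s own belief). The decrease is strict if and only if $i$ is orange. (ii) If $j\ne i$, then $r_i$ is weakly increasing on $J$ (in the belief of firm $j$). The increase is strict if and only if $i$ is orange and $j$ emits carbon (i.e., $j$ is not green).
   Context: Model. There are $n\ge1$ firms; constants $A,b,c,d>0$ and $K_{ex}\ge0$ are given. Firm $i$ chooses a technology $r_i\in[0,1]$ and a quantity $q_i\in[0,\infty)$; its carbon emission is $k_i=r_iq_i$. The convention $r_i=0$ is imposed whenever $q_i=0$. The number $\alpha_i^2=E_i[\alpha^2]$ (a symbol for a nonnegative real, the second moment of a random variable $\alpha$ under firm $i$'s subjective belief) is called the climate belief of firm $i$. Put $Q=\sum_j q_j$, $K=K_{ex}+\sum_j r_jq_j$, $Q_{-i}=Q-q_i$, $K_{-i}=K-k_i$. The expected profit of firm $i$ for a choice $(r,q)\in[0,1]\times[0,\infty)$ is $$(A-q-Q_{-i})^+\,q-b\alpha_i^2\,(rq+K_{-i})\,rq-(c+d-dr)\,q .$$ An equilibrium (Nash) is a profile $(r_j,q_j)_{1\le j\le n}$ such that for every $i$, $(r_i,q_i)$ maximizes firm $i$'s expected profit over $[0,1]\times[0,\infty)$ given $Q_{-i}=\sum_{j\ne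 i}q_j$ and $K_{-i}=K_{ex}+\sum_{j\ne i}r_jq_j$. For all parameters there is a unique equilibrium. Colors (in equilibrium). Firm $i$ is white if $q_i=0$; green if $q_i>0$ and $r_i=0$; orange if $q_i>0$ and $0<r_i<1$; red if $q_i>0$ and $r_i=1$. Standing assumptions. All climate beliefs are strictly positive, $\alpha_i^2>0$, and there are no white firms. Only regime-preserving perturbations are considered: $J\subseteq(0,\infty)$ is a nondegenerate interval such that for all $\alpha_j^2\in J$ (other parameters fixed) the equilibrium has no white firm, and the color of every firm is constant for $\alpha_j^2$ in the interior of $J$. ''Firm $i$ is green/orange/red'' refers to this constant color. *)

(* Defs.v *)
From mathcomp Require Import all_boot all_order all_algebra.
From mathcomp Require Import all_classical all_reals all_analysis.

Set Implicit Arguments.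
Unset Strict Implicit.
Unset Printing Implicit Defensive.

Import Order.TTheory GRing.Theory Num.Theory.
Import numFieldNormedType.Exports.

Local Open Scope ring_scope.

(* [a2] is the climate belief of the firm (the second moment itself, not its
   square root); [Qo] and [Ko] are the quantity and the carbon stock due to
   everyone else, so [Ko] includes the exogenous carbon. *)
Definition profit {R : realType} (A b c d a2 Qo Ko r q : R) : R :=
  Num.max (A - q - Qo) 0 * q - b * a2 * (r * q + Ko) * (r * q)
  - (c + d - d * r) * q.

Definition feasible {R : realType} (r q : R) : Prop := 0 <= r <= 1 /\ 0 <= q.

Definition others_quantity {R : realType} {n : nat} (q : 'I_n -> R) (i : 'I_n)
    : R :=
  \sum_(l < n | l != i) q l.

Definition others_carbon {R : realType} {n : nat} (Kex : R) (r q : 'I_n -> R)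
    (i : 'I_n) : R :=
  Kex + \sum_(l < n | l != i) r l * q l.

Definition equilibrium {R : realType} {n : nat} (A b c d Kex : R)
    (belief r q : 'I_n -> R) : Prop :=
  forall i : 'I_n,
    let pi_i := profit A b c d (belief i)
                  (others_quantity q i) (others_carbon Kex r q i) in
    [/\ feasible (r i) (q i),
        q i = 0 -> r i = 0
      & forall r' q' : R, feasible r' q' -> pi_i r' q' <= pi_i (r i) (q i)].

Inductive color := White | Green | Orange | Red.

Definition has_color {R : realType} (r q : R) (col : color) : Prop :=
  match col with
  | White => q = 0
  | Green => 0 < q /\ r = 0
  | Orange => 0 < q /\ 0 < r < 1
  | Red => 0 < q /\ r = 1
  end.

(* [r a] and [q a] form the equilibrium when firm [j] has belief [a] and every
   other firm [l] has belief [belief l]; the value [belief j] is irrelevant.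
   At an endpoint of [J] the colors may differ from [col]. *)
Definition regime_preserving {R : realType} {n : nat} (A b c d Kex : R)
    (belief : 'I_n -> R) (j : 'I_n) (J : set R) (r q : R -> 'I_n -> R)
    (col : 'I_n -> color) : Prop :=
  [/\ forall a, J a ->
        equilibrium A b c d Kex [eta belief with j |-> a] (r a) (q a),
      forall a i, J a -> ~ has_color (r a i) (q a i) White
    & forall a i, interior J a -> has_color (r a i) (q a i) (col i)].

Definition weakly_increasing_on {R : realType} (J : set R) (f : R -> R) : Prop :=
  forall x y, J x -> J y -> x <= y -> f x <= f y.

Definition strictly_increasing_on {R : realType} (J : set R) (f : R -> R)
    : Prop :=
  forall x y, J x -> J y -> x < y -> f x < f y.

Definition weakly_decreasing_on {R : realType} (J : set R) (f : R -> R) : Prop :=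
  forall x y, J x -> J y -> x <= y -> f y <= f x.

Definition strictly_decreasing_on {R : realType} (J : set R) (f : R -> R)
    : Prop :=
  forall x y, J x -> J y -> x < y -> f y < f x.

(* Main.v *)
Require Import Defs.
From mathcomp Require Import all_boot all_order all_algebra.
From mathcomp Require Import all_classical all_reals all_analysis.
From mathcomp Require Import lra.

Import Order.TTheory GRing.Theory Num.Theory.
Import numFieldNormedType.Exports.

Local Open Scope classical_set_scope.
Local Open Scope ring_scope.

(** Let Q and K be total output and total carbon, M = A - c - d and m = M - Q.
    With e = b times the climate belief, a firm sees the market only through
    (m, K): its first-order conditions say that r < 1 means q = m,
    and that the marginal value d - e (k + K) of its own emissions
    k = r q is nonpositive, zero or nonnegative according to whether the firm is
    green, orange or red, a red firm producing m + (d - e (k + K)).  An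
    equilibrium without white firms is thus a pair (m, K) at which these
    responses add up to Q = M - m and to K - Kex ([market]).

    Take two such markets that differ only in the belief of firm j, which is
    larger in the second, and let x = K - K' and y = m' - m, so that the sum of
    the output changes is - y and the sum of the emission changes is - x.  If
    0 <= y and x <= y, every firm changes its emissions by at most the change
    of its output ([emission_gap_le]): either it started with k = q, where
    k' <= q' suffices, or k < q at the start, and then its output rises by at
    least y and its emissions by at most max(x, 0).  Summing,
    - x <= - y, so y <= x.  If m falls and K rises, all emissions fall
    ([emission_le]), so K could not rise.  Together these yield 0 <= x and
    y <= x ([aggregate_shift]), whatever the colors in the two markets.

    For a firm i other than j this settles the matter: an orange firm has
    r = k / m with 0 < k < m, its k rises by x and its m by y <= x, so r rises,
    strictly unless x = y = 0 ([technology_le], [technology_lt]).  The aggregates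
    do move when j emits, since its belief enters its response through
    e (k + K) ([aggregates_move]); when j is green, its response is the same at
    the higher belief, and the comparison applied in both directions shows that
    nothing moves.  For j itself, the other firms' responses to (x, y) bound
    what is left for j in the two adding-up identities ([own_shift]), and this
    residual bound forces r to fall.

    The weak comparison thus covers endpoints of J, where colors may differ from
    those in the interior.  Strictness is obtained between two interior points and
    transported to J by weak monotonicity. *)

(** * Best responses of one firm *)

(** The first-order conditions of a firm that produces; the three cases are
    green, orange and red.  Here [e] is b times the belief, [m] is
    A - c - d - Q, and [K] contains the firm's own emissions [k], so that the
    derivative of the quadratic emission cost is [e * (k + K)]. *)
Definition best_response {R : realFieldType} (d e m K q k : R) : Prop :=
  0 < q /\
  [\/ [/\ k = 0, q = m & d <= e * (k + K)],
      [/\ 0 < k < q, q = m & d = e * (k + K)]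
    | [/\ k = q, q = m + (d - e * (k + K)) & e * (k + K) <= d]].

Section OneFirm.
Set Implicit Arguments.
Unset Strict Implicit.
Context {R : realFieldType}.
Implicit Types d e m K q k : R.

Lemma best_response_bounds {d e m K q k} :
  best_response d e m K q k -> [/\ 0 < q, 0 <= k, k <= q & m <= q].
Proof.
by move=> [q0 [[kE qE _]|[/andP[k0 kq] qE _]|[kE qE le_d]]]; split; lra.
Qed.

Lemma interior_best_response {d e m K q k} :
  best_response d e m K q k -> k < q -> q = m /\ d <= e * (k + K).
Proof. by move=> [q0 [[_ -> ?]|[_ -> ->]|[-> _ _]]]; rewrite ?ltxx. Qed.

Lemma emitting_best_response {d e m K q k} :
  best_response d e m K q k -> 0 < k -> e * (k + K) <= d.
Proof. by move=> [q0 [[-> _ _]|[_ _ ->]|[_ _ ?]]]; rewrite ?ltxx. Qed.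

(** If the marginal value d - e t of emissions goes from nonpositive to
    nonnegative although the carbon cost e has not fallen, then t has fallen. *)
Lemma le_carbon_index d e e' t t' :
  0 < e -> e <= e' -> 0 <= t' -> d <= e * t -> e' * t' <= d -> t' <= t.
Proof.
move=> e0 ee' t'0 h h'; rewrite leNgt; apply/negP => tt'.
have : e * t < e * t' by rewrite ltr_pM2l.
have : e * t' <= e' * t' by rewrite ler_wpM2r.
lra.
Qed.

(** A firm that starts with k < q has k' + K' <= k + K as long as it still
    emits afterwards, hence its emissions rise by at most the fall of K, while
    its output rises by at least m' - m.  The case k = q is immediate, since
    k' <= q'. *)
Lemma emission_gap_le d e e' m m' K K' q q' k k' :
  0 < e -> e <= e' -> 0 <= K' ->
  best_response d e m K q k -> best_response d e' m' K' q' k' ->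
  m <= m' -> K - K' <= m' - m -> k' - k <= q' - q.
Proof.
move=> e0 ee' K'0 br br' mm' Kmm.
have [q0 k0 kq mq] := best_response_bounds br.
have [q'0 k'0 k'q' m'q'] := best_response_bounds br'.
have [qk|kltq] := leP q k; first by lra.
have [qE dle] := interior_best_response br kltq.
have [k'le|k'gt] := leP k' 0; first by lra.
have := le_carbon_index (t := k + K) (t' := k' + K') e0 ee' _ dle
  (emitting_best_response br' k'gt).
lra.
Qed.

(** Emissions are discouraged by a larger carbon stock, by a larger cost, and, for
    a red firm, by a smaller margin m. *)
Lemma emission_le d e e' m m' K K' q q' k k' :
  0 < e -> e <= e' -> 0 <= K' ->
  best_response d e m K q k -> best_response d e' m' K' q' k' ->
  m' <= m -> K <= K' -> k' <= k.
Proof.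
move=> e0 ee' K'0 br br' m'm KK'.
have [q0 k0 kq mq] := best_response_bounds br.
have [q'0 k'0 k'q' m'q'] := best_response_bounds br'.
have [k'le|k'gt] := leP k' 0; first by lra.
have em := emitting_best_response br' k'gt.
have [kltq|qk] := ltP k q.
  have [qE dle] := interior_best_response br kltq.
  have := le_carbon_index (t := k + K) (t' := k' + K') e0 ee' _ dle em.
  lra.
case: br => _ [[? _ _]|[/andP[_ ?] _ _]|[kE qE le_d]]; [lra|lra|].
case: br' => _ [[? _ _]|[/andP[_ ?] ? _]|[k'E q'E _]]; [lra|lra|].
rewrite leNgt; apply/negP => kk'.
have h1 : e * (k + K) <= e * (k' + K') by rewrite ler_pM2l //; lra.
have h2 : e * (k' + K') <= e' * (k' + K') by rewrite ler_wpM2r //; lra.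
lra.
Qed.

(** Output is m for a firm with k < q, and equals emissions for a red one. *)
Lemma output_le d e e' m m' K K' q q' k k' :
  0 < e -> e <= e' -> 0 <= K' ->
  best_response d e m K q k -> best_response d e' m' K' q' k' ->
  m' <= m -> K <= K' -> q' <= q.
Proof.
move=> e0 ee' K'0 br br' m'm KK'.
have kk' := emission_le e0 ee' K'0 br br' m'm KK'.
have [q0 k0 kq mq] := best_response_bounds br.
have [q'0 k'0 k'q' m'q'] := best_response_bounds br'.
have [k'lt|q'k'] := ltP k' q'; last by lra.
have [q'E _] := interior_best_response br' k'lt.
lra.
Qed.

(** Both technology lemmas are stated with cross products k q' and k' q in place
    of the ratios k / q and k' / q'. *)
Lemma technology_le d e m m' K K' q q' k k' :
  0 < e -> 0 <= K ->
  best_response d e m K q k -> best_response d e m' K' q' k' ->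
  K' <= K -> m' - m <= K - K' -> k * q' <= k' * q.
Proof.
move=> e0 K0 br br' K'K mmK.
have [q0 k0 kq mq] := best_response_bounds br.
have [q'0 k'0 k'q' m'q'] := best_response_bounds br'.
have [q'k'|k'lt] := leP q' k'.
  have -> : k' = q' by lra.
  by rewrite (mulrC q') ler_wpM2r // ltW.
have [q'E dle'] := interior_best_response br' k'lt.
have [kle|kgt] := leP k 0.
  have -> : k = 0 by lra.
  by rewrite mul0r mulr_ge0 // ltW.
have em := emitting_best_response br kgt.
have kk' := le_carbon_index (t := k' + K') (t' := k + K) e0 (lexx e) _ dle' em.
have {}kk' : k + (K - K') <= k' by lra.
have kltq : k < q by lra.
have [qE _] := interior_best_response br kltq.
(* Since k <= q = m and y <= x, one has k (m + y) <= (k + x) m. *)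
have h1 : (m' - m) * k <= (K - K') * k by rewrite ler_wpM2r.
have h2 : (K - K') * k <= (K - K') * q by rewrite ler_wpM2l //; lra.
have h3 : (k + (K - K')) * q <= k' * q by rewrite ler_wpM2r // ltW.
rewrite q'E; apply: le_trans h3; rewrite qE in h2 *; lra.
Qed.

(** For a firm orange in both markets k + K is pinned down by e, so k rises by
    exactly x = K - K', and k (m + y) < (k + x) m because 0 < k < m. *)
Lemma technology_lt d e m m' K K' q q' k k' :
  0 < e ->
  best_response d e m K q k -> best_response d e m' K' q' k' ->
  0 < k < q -> 0 < k' < q' ->
  K' <= K -> m' - m <= K - K' -> (K, m) <> (K', m') -> k * q' < k' * q.
Proof.
move=> e0 br br' /andP[k0 kq] /andP[k'0 k'q'] K'K mmK neq.
have [qE dle] := interior_best_response br kq.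
have [q'E dle'] := interior_best_response br' k'q'.
have eK : e * (k + K) = e * (k' + K').
  have := emitting_best_response br k0.
  have := emitting_best_response br' k'0.
  lra.
have {eK} : k + K = k' + K' by apply: (mulfI (lt0r_neq0 e0)).
move=> eK; have -> : k' = k + (K - K') by lra.
rewrite q'E qE.
have [lt|ge] := ltP 0 (K - K').
  have h1 : (m' - m) * k <= (K - K') * k by rewrite ler_pM2r.
  have h2 : (K - K') * k < (K - K') * m by rewrite ltr_pM2l //; lra.
  lra.
have EK : K = K' by lra.
have [lt|ge'] := ltP m' m; last by case: neq; congr (_, _); lra.
have : (m' - m) * k < 0 by rewrite nmulr_rlt0 //; lra.
by rewrite EK; lra.
Qed.

End OneFirm.

(** * Two markets that differ in one belief *)

(** An equilibrium without white firms, reduced to its aggregates: [M] is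
    A - c - d, and [M - m] is total output. *)
Definition market {R : realFieldType} {n : nat} (M d Kex : R)
    (e : 'I_n -> R) (m K : R) (q k : 'I_n -> R) : Prop :=
  [/\ 0 <= K, m + \sum_i q i = M, K = Kex + \sum_i k i
    & forall i, best_response d (e i) m K (q i) (k i)].

Section TwoMarkets.
Set Implicit Arguments.
Unset Strict Implicit.
Context {R : realFieldType} {n : nat} (M d Kex : R) (j : 'I_n).
Context (e e' : 'I_n -> R) (m m' K K' : R) (q q' k k' : 'I_n -> R).
Hypothesis e_gt0 : forall i, 0 < e i.
Hypothesis e_eq : forall i, i != j -> e i = e' i.
Hypothesis e_le : e j <= e' j.
Hypothesis mk : market M d Kex e m K q k.
Hypothesis mk' : market M d Kex e' m' K' q' k'.

Let e_le_all i : e i <= e' i.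
Proof. by have [->//|ij] := eqVneq i j; rewrite e_eq. Qed.

Let split_own (f : 'I_n -> R) : \sum_i f i = f j + \sum_(i < n | i != j) f i.
Proof. exact: bigD1. Qed.

(** The two ways of violating the conclusion are excluded by summing
    [emission_gap_le] or [emission_le] over all firms, firm j included. *)
Lemma aggregate_shift : K' <= K /\ m' - m <= K - K'.
Proof.
case: mk => K0 hQ hK br; case: mk' => K'0 hQ' hK' br'.
have gap : m <= m' -> K - K' <= m' - m -> m' - m <= K - K'.
  move=> h1 h2.
  have : \sum_i (k' i - k i) <= \sum_i (q' i - q i).
    apply: ler_sum => i _.
    exact: (emission_gap_le (e_gt0 i) (e_le_all i) K'0
      (br i) (br' i)).
  by rewrite !sumrB; lra.
have dec : m' <= m -> K <= K' -> K' <= K.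
  move=> h1 h2.
  have : \sum_i k' i <= \sum_i k i.
    apply: ler_sum => i _.
    exact: (emission_le (e_gt0 i) (e_le_all i) K'0
      (br i) (br' i)).
  by lra.
have [mm'|m'm] := leP m m'.
  by have [/(gap mm')|] := leP (K - K') (m' - m); split; lra.
by have [/(dec (ltW m'm))|] := leP K K'; split; lra.
Qed.

Lemma technology_le_other i : i != j -> k i * q' i <= k' i * q i.
Proof.
move=> ij; have [hK hm] := aggregate_shift.
case: mk => K0 _ _ /(_ i) br; case: mk' => _ _ _ /(_ i) br'.
rewrite -e_eq // in br'.
exact: technology_le (e_gt0 i) K0 br br' hK hm.
Qed.

(** The responses of the other firms are determined by (m, K), so firm j, being
    the residual in both adding-up identities, cannot move either. *)
Lemma same_aggregates : (K, m) = (K', m') -> q j = q' j /\ k j = k' j.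
Proof.
move=> [hK hm].
case: mk => K0 hQ hKx br; case: mk' => K'0 hQ' hKx' br'.
have others i : i != j -> q i = q' i /\ k i = k' i.
  move=> ij; have bi := br i; have bi' := br' i.
  rewrite -e_eq // in bi'; have ei := e_gt0 i.
  rewrite -hK in K'0 bi'; rewrite -hm in bi'.
  split; apply/eqP; rewrite eq_le; apply/andP; split.
  - exact: output_le ei (lexx _) K0 bi' bi (lexx _) (lexx _).
  - exact: output_le ei (lexx _) K0 bi bi' (lexx _) (lexx _).
  - exact: emission_le ei (lexx _) K0 bi' bi (lexx _) (lexx _).
  - exact: emission_le ei (lexx _) K0 bi bi' (lexx _) (lexx _).
rewrite split_own in hQ; rewrite split_own in hQ'.
rewrite split_own in hKx; rewrite split_own in hKx'.
have sq : \sum_(i < n | i != j) q i = \sum_(i < n | i != j) q' i.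
  by apply: eq_bigr => i /others[].
have sk : \sum_(i < n | i != j) k i = \sum_(i < n | i != j) k' i.
  by apply: eq_bigr => i /others[].
by split; lra.
Qed.

(** Firm j is the residual.  If m does not fall, the other firms raise both outputs and
    emissions, which bounds the changes of firm j separately.  If m falls, the
    other firms raise emissions by at least as much as output ([emission_gap_le] with the
    markets exchanged), which bounds only the difference of the two changes. *)
Lemma own_shift :
  [\/ [/\ m <= m', q' j - q j <= m - m' & k' j - k j <= K' - K]
    | [/\ m' < m, K' <= K & (k' j - q' j) - (k j - q j) <= (m' - m) - (K - K')]].
Proof.
have [hK hm] := aggregate_shift.
case: mk => K0 hQ hKx br; case: mk' => K'0 hQ' hKx' br'.
rewrite split_own in hQ; rewrite split_own in hQ'.
rewrite split_own in hKx; rewrite split_own in hKx'.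
have [mm'|m'm] := leP m m'; [left|right]; split => //.
- have : \sum_(i < n | i != j) q i <= \sum_(i < n | i != j) q' i.
    apply: ler_sum => i ij; have bi := br' i; rewrite -e_eq // in bi.
    exact: output_le (e_gt0 i) (lexx _) K0 bi (br i) mm' hK.
  by lra.
- have : \sum_(i < n | i != j) k i <= \sum_(i < n | i != j) k' i.
    apply: ler_sum => i ij; have bi := br' i; rewrite -e_eq // in bi.
    exact: emission_le (e_gt0 i) (lexx _) K0 bi (br i) mm' hK.
  by lra.
- have : \sum_(i < n | i != j) (k i - k' i) <= \sum_(i < n | i != j) (q i - q' i).
    apply: ler_sum => i ij; have bi := br' i; rewrite -e_eq // in bi.
    apply: (emission_gap_le (e_gt0 i) (lexx _) K0 bi
      (br i)); lra.
  by rewrite !sumrB; lra.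
Qed.

(** The claim is immediate if j starts at k = q.  Otherwise its output is m; if m
    does not fall, [own_shift] leaves room only for a constant output and
    emissions that do not rise, and if m falls, it keeps k' < q' and makes
    emissions fall by at least as much as output, which lowers their ratio since k < q. *)
Lemma technology_le_own : k' j * q j <= k j * q' j.
Proof.
case: mk => _ _ _ /(_ j) br; case: mk' => _ _ _ /(_ j) br'.
have [q0 k0 kq mq] := best_response_bounds br.
have [q'0 k'0 k'q' m'q'] := best_response_bounds br'.
have [qk|kltq] := leP (q j) (k j).
  have -> : k j = q j by lra.
  by rewrite (mulrC (q j)) ler_wpM2r // ltW.
have [qE _] := interior_best_response br kltq.
case: own_shift => -[h1 h2 h3].
  (* Here q' >= m' >= m = q, while own_shift gives q' <= q - (m' - m). *)
  have [hK _] := aggregate_shift.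
  have -> : q' j = q j by lra.
  by rewrite ler_wpM2r //; lra.
have [q'k'|k'lt] := leP (q' j) (k' j); first by lra.
have [q'E _] := interior_best_response br' k'lt.
have h4 : (m' - m) * q j <= (m' - m) * k j by rewrite ler_wnM2l //; lra.
have h5 : (k' j - k j) * q j <= (m' - m) * q j.
  by rewrite ler_wpM2r //; lra.
rewrite q'E; rewrite qE in h4 h5 *; lra.
Qed.

Hypothesis e_lt : e j < e' j.

Lemma technology_lt_own :
  0 < k j < q j -> 0 < k' j < q' j -> k' j * q j < k j * q' j.
Proof.
move=> /andP[k0 kq] /andP[k'0 k'q'].
case: mk => K0 _ _ /(_ j) br; case: mk' => K'0 _ _ /(_ j) br'.
have [qE dle] := interior_best_response br kq.
have [q'E dle'] := interior_best_response br' k'q'.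
have q0 : 0 < q j by lra.
case: own_shift => -[h1 h2 h3].
  have [hK _] := aggregate_shift.
  have -> : q' j = q j by lra.
  rewrite ltr_pM2r //.
  have em := emitting_best_response br k0.
  have em' := emitting_best_response br' k'0.
  have [//|kk'] := ltP (k' j) (k j).
  have : e j * (k j + K) < e' j * (k j + K) by rewrite ltr_pM2r //; lra.
  have kK : k j + K = k' j + K' by lra.
  by rewrite kK in dle *; lra.
have h4 : (m' - m) * q j <= (m' - m) * k j by rewrite ler_wnM2l //; lra.
have h5 : (k' j - k j) * q j < (m' - m) * q j.
  by rewrite ltr_pM2r //; lra.
rewrite q'E; rewrite qE in h4 h5 *; lra.
Qed.

(** With unchanged aggregates firm j would keep q and k, but its marginal carbon
    cost e (k + K) has increased, and an emitting firm's response determines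
    that cost from (m, q). *)
Lemma aggregates_move : 0 < k j -> 0 < k' j -> (K, m) <> (K', m').
Proof.
move=> kj0 k'j0 E; have [qq kk] := same_aggregates E.
case: E => EK Em.
case: mk => K0 _ _ /(_ j) [q0 br]; case: mk' => _ _ _ /(_ j) [_ br'].
rewrite -EK -Em -qq -kk in br'.
have : e j * (k j + K) < e' j * (k j + K) by rewrite ltr_pM2r //; lra.
by case: br => -[c1 c2 c3]; case: br' => -[c1' c2' c3']; lra.
Qed.

Lemma technology_lt_other i : i != j -> 0 < k j -> 0 < k' j ->
  0 < k i < q i -> 0 < k' i < q' i -> k i * q' i < k' i * q i.
Proof.
move=> ij kj k'j oi oi'; have [hK hm] := aggregate_shift.
case: (mk) => _ _ _ /(_ i) br; case: (mk') => _ _ _ /(_ i) br'.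
rewrite -e_eq // in br'.
exact: technology_lt (e_gt0 i) br br' oi oi' hK hm (aggregates_move kj k'j).
Qed.

End TwoMarkets.

(** * First-order conditions at an equilibrium *)

Lemma slope_le0 {R : realFieldType} {g C eps : R} :
  0 < eps -> (forall t, 0 < t <= eps -> t * g <= t ^+ 2 * C) -> g <= 0.
Proof.
move=> eps0 H; rewrite leNgt; apply/negP => g0.
have C0 : 0 < `|C| + 1 by have := normr_ge0 C; lra.
pose t := Num.min eps (g / (2 * (`|C| + 1))).
have t0 : 0 < t by rewrite lt_min eps0 divr_gt0 // mulr_gt0.
have := H t; rewrite t0 ge_min lexx expr2 -mulrA ler_pM2l // => /(_ isT) gtC.
have : t * (2 * (`|C| + 1)) <= g.
  by rewrite -ler_pdivlMr ?mulr_gt0 // ge_min lexx orbT.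
have : t * C <= t * (`|C| + 1).
  by rewrite ler_pM2l //; have := ler_norm C; lra.
lra.
Qed.

(** In the variables (q, k) the feasible set is the cone 0 <= k <= q, and the
    profit is a concave quadratic wherever the price is positive.  A producing
    firm faces a positive price, because otherwise it would rather shut down;
    away from there the quadratic bounds the profit from below, so the firm's
    choice maximizes the quadratic on the whole cone.  The conditions follow
    by moving along the directions (1,0), (-1,0), (0,1), (0,-1), (1,1) and
    (-1,-1) that are feasible in each case. *)
Lemma maximizer_best_response {R : realType} {A b c d a Qo Ko r q : R} :
  0 < b -> 0 < a -> 0 < c -> 0 < d -> 0 <= Ko -> feasible r q -> 0 < q ->
  (forall r' q', feasible r' q' ->
     profit A b c d a Qo Ko r' q' <= profit A b c d a Qo Ko r q) ->
  best_response d (b * a) (A - c - d - (q + Qo)) (r * q + Ko) q (r * q).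
Proof.
move=> b0 a0 c0 d0 Ko0 [/andP[r0 r1] _] q0 opt.
have e0 : 0 < b * a by rewrite mulr_gt0.
have k0 : 0 <= r * q by rewrite mulr_ge0 // ltW.
have kq : r * q <= q by rewrite ler_piMl // ltW.
have drq : d * r * q = d * (r * q) by rewrite mulrA.
pose f x y := (A - x - Qo) * x - b * a * (y + Ko) * y - (c + d) * x + d * y.
have price : 0 < A - q - Qo.
  rewrite ltNge; apply/negP => le0.
  have := opt 0 0; rewrite /profit (max_idPr le0) !mul0r !mulr0 subr0 subr0.
  move=> /(_ (conj _ _)); rewrite !lexx ler01 => /(_ isT isT).
  have : 0 <= b * a * (r * q + Ko) * (r * q).
    by rewrite !mulr_ge0 ?addr_ge0 // ltW.
  have : d * (r * q) <= d * q by rewrite ler_pM2l.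
  have : 0 < c * q by rewrite mulr_gt0.
  by rewrite mulrBl drq mulrDl; lra.
have fmax x y : 0 <= y <= x -> f x y <= f q (r * q).
  move=> /andP[y0 yx]; have x0 : 0 <= x by lra.
  have feas : feasible (y / x) x.
    split=> //; have [->|xn0] := eqVneq x 0; first by rewrite invr0 mulr0 lexx ler01.
    have {}x0 : 0 < x by rewrite lt_def xn0.
    by apply/andP; split; [by rewrite divr_ge0 // ltW|rewrite ler_pdivrMr // mul1r].
  have yE : y / x * x = y.
    have [x00|xn0] := eqVneq x 0; last by rewrite divfK.
    by rewrite x00 mulr0; lra.
  have := opt _ _ feas; rewrite /profit yE (max_idPl (ltW price)).
  have : (A - x - Qo) * x <= Num.max (A - x - Qo) 0 * x.
    by rewrite ler_wpM2r // le_max lexx.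
  have dy : d * (y / x) * x = d * y by rewrite -mulrA yE.
  by rewrite /f !mulrBl drq dy; lra.
move: fmax; rewrite {}/f => fmax.
set k := r * q in k0 kq fmax *; set e := b * a in e0 fmax *.
set m := A - c - d - (q + Qo).
have direction u v eps : 0 < eps ->
    (forall t, 0 < t <= eps -> 0 <= k + t * v <= q + t * u) ->
    (m - q) * u + (d - e * (k + (k + Ko))) * v <= 0.
  move=> eps0 feas; apply: (slope_le0 (C := u ^+ 2 + e * v ^+ 2) eps0).
  by move=> t /feas /fmax; rewrite /m; lra.
have up : m - q <= 0.
  suff: (m - q) * 1 + (d - e * (k + (k + Ko))) * 0 <= 0 by lra.
  by apply: (direction _ _ 1) => // t; lra.
have cleaner : k < q -> q = m /\ d <= e * (k + (k + Ko)).
  move=> kltq; have gap : 0 < q - k by lra.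
  have h : (m - q) * (- 1) + (d - e * (k + (k + Ko))) * 0 <= 0.
    by apply: (direction _ _ _ gap) => t; lra.
  have h' : (m - q) * 0 + (d - e * (k + (k + Ko))) * 1 <= 0.
    by apply: (direction _ _ _ gap) => t; lra.
  by split; lra.
have dirtier : 0 < k -> e * (k + (k + Ko)) <= d.
  move=> kgt0.
  suff: (m - q) * 0 + (d - e * (k + (k + Ko))) * (- 1) <= 0 by lra.
  by apply: (direction _ _ _ kgt0) => t; lra.
split=> //; have [kltq|qk] := ltP k q.
  have [qm dle] := cleaner kltq.
  have [kle0|kgt0] := leP k 0; first by constructor 1; split=> //; lra.
  by constructor 2; split; [exact/andP| |have := dirtier kgt0; lra].
have kE : k = q by lra.
constructor 3; split=> //; last by apply: dirtier; lra.
have h1 : (m - q) * 1 + (d - e * (k + (k + Ko))) * 1 <= 0.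
  by apply: (direction _ _ 1) => // t; lra.
have h2 : (m - q) * (- 1) + (d - e * (k + (k + Ko))) * (- 1) <= 0.
  by apply: (direction _ _ _ q0) => t; lra.
lra.
Qed.

Lemma equilibrium_market {R : realType} {n : nat} {A b c d Kex : R}
    {belief r q : 'I_n -> R} :
  0 < b -> 0 < c -> 0 < d -> 0 <= Kex -> (forall i, 0 < belief i) ->
  (forall i, q i <> 0) -> equilibrium A b c d Kex belief r q ->
  market (A - c - d) d Kex (fun i => b * belief i)
    (A - c - d - \sum_i q i) (Kex + \sum_i r i * q i) q (fun i => r i * q i).
Proof.
move=> b0 c0 d0 Kex0 a0 qn0 eq.
have feas i : feasible (r i) (q i) by have [] := eq i.
have k0 i : 0 <= r i * q i by case: (feas i) => /andP[? _] ?; rewrite mulr_ge0.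
split=> //; first by rewrite addr_ge0 // sumr_ge0.
  by rewrite subrK.
move=> i; have [_ _ opt] := eq i.
have qi0 : 0 < q i by case: (feas i) => _; rewrite lt_def => ->; rewrite andbT; apply/eqP.
have Ko0 : 0 <= others_carbon Kex r q i by rewrite addr_ge0 // sumr_ge0.
have := maximizer_best_response b0 (a0 i) c0 d0 Ko0 (feas i) qi0 opt.
rewrite /others_quantity /others_carbon.
have -> : q i + \sum_(l < n | l != i) q l = \sum_l q l.
  by rewrite [RHS](bigD1 i).
have -> : r i * q i + (Kex + \sum_(l < n | l != i) r l * q l)
          = Kex + \sum_l r l * q l.
  by rewrite [in RHS](bigD1 i) //= addrCA.
by [].
Qed.

(** * Monotonicity on an interval and on its interior *)

Lemma interval_interior {R : realType} {J : set R} {x y z : R} :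
  is_interval J -> J x -> J y -> x < z < y -> interior J z.
Proof.
move=> Jint Jx Jy xzy.
have : nbhs z [set` `]x, y[] by apply: near_in_itvoo; rewrite in_itv.
apply: filterS => t /=; rewrite in_itv /= => /andP[xt ty].
by apply: (Jint x y) => //; rewrite !ltW.
Qed.

Lemma interior_pair {R : realType} {J : set R} {x y : R} :
  is_interval J -> J x -> J y -> x < y ->
  exists u v, [/\ interior J u, interior J v & x < u < v /\ v < y].
Proof.
move=> Jint Jx Jy xy.
exists (x + (y - x) / 3), (y - (y - x) / 3); split; last by lra.
  by apply: (interval_interior Jint Jx Jy); lra.
by apply: (interval_interior Jint Jx Jy); lra.
Qed.

Lemma strictly_increasing_from_interior {R : realType} {J : set R} {f : R -> R} :
  is_interval J -> weakly_increasing_on J f ->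
  strictly_increasing_on (interior J) f -> strictly_increasing_on J f.
Proof.
move=> Jint wf sf x y Jx Jy xy.
have [u [v [iu iv [/andP[xu uv] vy]]]] := interior_pair Jint Jx Jy xy.
apply: (le_lt_trans (wf _ _ Jx (interior_subset iu) (ltW xu))).
exact: lt_le_trans (sf _ _ iu iv uv) (wf _ _ (interior_subset iv) Jy (ltW vy)).
Qed.

Lemma not_strict_of_const {R : realType} {J : set R} {f : R -> R} :
  is_interval J -> (exists x y, [/\ J x, J y & x < y]) ->
  (forall u v, interior J u -> interior J v -> u < v -> f v = f u) ->
  ~ strictly_increasing_on J f.
Proof.
move=> Jint [x [y [Jx Jy xy]]] fcst sf.
have [u [v [iu iv [/andP[_ uv] _]]]] := interior_pair Jint Jx Jy xy.
have := sf _ _ (interior_subset iu) (interior_subset iv) uv.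
by rewrite (fcst _ _ iu iv uv) ltxx.
Qed.

(** * Technology as a function of the belief of firm j *)

Lemma technology_ratio {R : realFieldType} {r r' q q' : R} :
  0 < q -> 0 < q' ->
  ((r * q * q' <= r' * q' * q) = (r <= r')) *
  ((r * q * q' < r' * q' * q) = (r < r')).
Proof.
move=> q0 q'0; rewrite -!mulrA (mulrC q').
by rewrite ler_pM2r ?ltr_pM2r ?mulr_gt0.
Qed.

Lemma orange_emission {R : realType} {r q : R} :
  has_color r q Orange -> 0 < r * q < q.
Proof. by move=> [q0 /andP[r0 r1]]; rewrite mulr_gt0 //= gtr_pMl. Qed.

Section BeliefShift.
Set Implicit Arguments.
Unset Strict Implicit.
Context {R : realType} {n : nat} (A b c d Kex : R).
Hypotheses (hb : 0 < b) (hc : 0 < c) (hd : 0 < d) (hKex : 0 <= Kex).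
Context (belief : 'I_n -> R) (j : 'I_n).
Hypothesis hbelief : forall l : 'I_n, l != j -> 0 < belief l.
Context (J : set R).
Hypothesis hJpos : forall a : R, J a -> 0 < a.
Hypothesis hJint : is_interval J.
Hypothesis hJnondeg : exists x y : R, [/\ J x, J y & x < y].
Context (r q : R -> 'I_n -> R) (col : 'I_n -> color).
Hypothesis hregime : regime_preserving A b c d Kex belief j J r q col.

Let cost (a : R) (i : 'I_n) : R := b * [eta belief with j |-> a] i.
Let k (a : R) (i : 'I_n) : R := r a i * q a i.
Let m (a : R) : R := A - c - d - \sum_i q a i.
Let K (a : R) : R := Kex + \sum_i k a i.

Let belief_gt0 a : J a -> forall i, 0 < [eta belief with j |-> a] i.
Proof.
by move=> /hJpos a0 i /=; have [//|ij] := eqVneq i j; exact: hbelief.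
Qed.

Let cost_gt0 a : J a -> forall i, 0 < cost a i.
Proof. by move=> Ja i; rewrite mulr_gt0 // belief_gt0. Qed.

Let cost_other u v i : i != j -> cost u i = cost v i.
Proof. by move=> ij; rewrite /cost /= (negPf ij). Qed.

Let cost_own u : cost u j = b * u.
Proof. by rewrite /cost /= eqxx. Qed.

Let cost_own_le u v : u <= v -> cost u j <= cost v j.
Proof. by rewrite !cost_own ler_pM2l. Qed.

Let q_gt0 a i : J a -> 0 < q a i.
Proof.
move=> Ja; case: hregime => heq hw _.
have [[_ q0] _ _] := heq a Ja i.
by rewrite lt_def q0 andbT; apply/eqP/(hw a i Ja).
Qed.

Let marketJ a : J a -> market (A - c - d) d Kex (cost a) (m a) (K a) (q a) (k a).
Proof.
move=> Ja; case: hregime => heq hw _.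
exact: equilibrium_market hb hc hd hKex (belief_gt0 Ja) (fun i => hw a i Ja)
  (heq a Ja).
Qed.

Let colored a i : interior J a -> has_color (r a i) (q a i) (col i).
Proof. by case: hregime => _ _; apply. Qed.

Let interiorJ a : interior J a -> J a.
Proof. exact: interior_subset. Qed.

Let uncolored_const i u v : col i <> Orange -> interior J u -> interior J v ->
  r v i = r u i.
Proof.
move=> notO iu iv; have := colored i iu; have := colored i iv.
have := q_gt0 i (interiorJ iu).
case: (col i) notO => //= _.
- by move=> + _ => /[swap] ->; rewrite ltxx.
- by move=> _ [_ ->] [_ ->].
- by move=> _ [_ ->] [_ ->].
Qed.

Lemma own_technology_weak : weakly_decreasing_on J (fun a => r a j).
Proof.
move=> u v Ju Jv uv.
rewrite -(technology_ratio (q_gt0 j Jv) (q_gt0 j Ju)).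
exact: technology_le_own (cost_gt0 Ju) (@cost_other u v) (cost_own_le uv)
  (marketJ Ju) (marketJ Jv).
Qed.

Lemma other_technology_weak i : i != j ->
  weakly_increasing_on J (fun a => r a i).
Proof.
move=> ij u v Ju Jv uv.
rewrite -(technology_ratio (q_gt0 i Ju) (q_gt0 i Jv)).
exact: technology_le_other (cost_gt0 Ju) (@cost_other u v) (cost_own_le uv)
  (marketJ Ju) (marketJ Jv) i ij.
Qed.

Lemma own_technology_strict :
  strictly_decreasing_on J (fun a => r a j) <-> col j = Orange.
Proof.
split=> [sd|cj].
  have [//|notO] : col j = Orange \/ col j <> Orange by case: (col j); ((by left) || by right).
  case: (not_strict_of_const hJint hJnondeg (f := fun a => - r a j)).
    by move=> u v iu iv _; rewrite (uncolored_const notO iu iv).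
  by move=> x y Jx Jy xy; rewrite ltrN2; exact: sd.
suff sN : strictly_increasing_on J (fun a => - r a j).
  by move=> x y Jx Jy xy; rewrite -ltrN2; exact: sN.
apply: strictly_increasing_from_interior => //.
  by move=> x y Jx Jy xy; rewrite lerN2; exact: own_technology_weak.
move=> u v iu iv uv; have Ju := interiorJ iu; have Jv := interiorJ iv.
rewrite ltrN2 -(technology_ratio (q_gt0 j Jv) (q_gt0 j Ju)).
have cu := colored j iu; have cv := colored j iv; rewrite cj in cu cv.
have elt : cost u j < cost v j by rewrite !cost_own ltr_pM2l.
exact: technology_lt_own (cost_gt0 Ju) (@cost_other u v) (ltW elt)
  (marketJ Ju) (marketJ Jv) elt (orange_emission cu) (orange_emission cv).
Qed.

(** The market at the lower belief u solves the one at the higher belief v as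
    well: a green firm has d <= e K, which survives an increase of e.  The weak
    comparison at the single belief v, used in both directions, then says that
    both markets have the same technologies outside j. *)
Let green_const i u v : i != j -> col j = Green ->
  interior J u -> interior J v -> u < v -> r v i = r u i.
Proof.
move=> ij cj iu iv uv; have Ju := interiorJ iu; have Jv := interiorJ iv.
have := colored j iu; rewrite cj => -[_ ru0].
have mu : market (A - c - d) d Kex (cost v) (m u) (K u) (q u) (k u).
  case: (marketJ Ju) => K0 hQ hK br; split => // l.
  have [->|lj] := eqVneq l j; last by rewrite (cost_other v u lj).
  have kj0 : k u j = 0 by rewrite /k ru0 mul0r.
  have kq : k u j < q u j by rewrite kj0 q_gt0.
  have [qE le1] := interior_best_response (br j) kq.
  split; first exact: q_gt0.
  constructor 1; split => //.
  apply: le_trans le1 _; rewrite ler_wpM2r //; first by rewrite kj0 add0r.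
  exact: cost_own_le (ltW uv).
apply/le_anti/andP; split.
  rewrite -(technology_ratio (q_gt0 i Jv) (q_gt0 i Ju)).
  exact: technology_le_other (cost_gt0 Jv) (fun _ _ => erefl) (lexx _)
    (marketJ Jv) mu i ij.
rewrite -(technology_ratio (q_gt0 i Ju) (q_gt0 i Jv)).
exact: technology_le_other (cost_gt0 Jv) (fun _ _ => erefl) (lexx _)
  mu (marketJ Jv) i ij.
Qed.

Lemma other_technology_strict i : i != j ->
  strictly_increasing_on J (fun a => r a i) <->
  col i = Orange /\ col j <> Green.
Proof.
move=> ij; split=> [si|[ci cj]].
  split.
    have [//|notO] : col i = Orange \/ col i <> Orange by case: (col i); ((by left) || by right).
    case: (not_strict_of_const hJint hJnondeg (f := fun a => r a i)) => //.
    by move=> u v iu iv _; exact: uncolored_const.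
  move=> cj.
  case: (not_strict_of_const hJint hJnondeg (f := fun a => r a i)) => //.
  by move=> u v iu iv uv; exact: green_const.
apply: strictly_increasing_from_interior => //.
  exact: other_technology_weak.
have emits a : interior J a -> 0 < k a j.
  move=> ia; have := colored j ia; have q0 := q_gt0 j (interiorJ ia).
  rewrite /k; case: (col j) cj => //=.
  - by move=> _ q00; rewrite q00 ltxx in q0.
  - by move=> _ [_ /andP[r0 _]]; rewrite mulr_gt0.
  - by move=> _ [_ ->]; rewrite mul1r.
move=> u v iu iv uv; have Ju := interiorJ iu; have Jv := interiorJ iv.
rewrite -(technology_ratio (q_gt0 i Ju) (q_gt0 i Jv)).
have cu := colored i iu; have cv := colored i iv; rewrite ci in cu cv.
have elt : cost u j < cost v j by rewrite !cost_own ltr_pM2l.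
exact: technology_lt_other (cost_gt0 Ju) (@cost_other u v) (ltW elt)
  (marketJ Ju) (marketJ Jv) elt i ij (emits u iu) (emits v iv)
  (orange_emission cu) (orange_emission cv).
Qed.

End BeliefShift.

Theorem theorem4p2 (R : realType) (n : nat) (A b c d Kex : R)
    (hA : 0 < A) (hb : 0 < b) (hc : 0 < c) (hd : 0 < d) (hKex : 0 <= Kex)
    (belief : 'I_n -> R) (j : 'I_n)
    (hbelief : forall l : 'I_n, l != j -> 0 < belief l)
    (J : set R) (hJpos : forall a : R, J a -> 0 < a)
    (hJint : is_interval J)
    (hJnondeg : exists x y : R, [/\ J x, J y & x < y])
    (r q : R -> 'I_n -> R) (col : 'I_n -> color)
    (hregime : regime_preserving A b c d Kex belief j J r q col) :
  (weakly_decreasing_on J (fun a => r a j) /\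
   (strictly_decreasing_on J (fun a => r a j) <-> col j = Orange)) /\
  (forall i : 'I_n, i != j ->
     weakly_increasing_on J (fun a => r a i) /\
     (strictly_increasing_on J (fun a => r a i) <->
      col i = Orange /\ col j <> Green)).
Proof.
split.
  split.
    exact: (own_technology_weak hb hc hd hKex hbelief hJpos hregime).
  exact: (own_technology_strict hb hc hd hKex hbelief hJpos hJint hJnondeg
    hregime).
move=> i ij; split.
  exact: (other_technology_weak hb hc hd hKex hbelief hJpos hregime ij).
exact: (other_technology_strict hb hc hd hKex hbelief hJpos hJint hJnondeg
  hregime ij).
Qed.
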